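(* Let $K$ be a $\sigma$-field of characteristic $0$, let $n$ be a positive integer, and let $I\subseteq K\{y_1,\ldots,y_n\}$ be a pure binomial $\sigma$-ideal. Then $\langle I\rangle_r$ is finitely generated as a radical well-mixed $\sigma$-ideal, i.e. there is a finite set $F\subseteq K\{y_1,\ldots,y_n\}$ such that $\langle I\rangle_r=\langle F\rangle_r$.
   Context: All rings are commutative and unital; $\mathbb{N}$ contains $0$. A $\sigma$-ring is a ring $R$ with a ring endomorphism $\sigma:R\to R$; a $\sigma$-field is a $\sigma$-ring that is a field. For $p=\sum_{i=0}^s c_ix^i\in\mathbb{N}[x]$ and $a$ in a $\sigma$-ring, $a^p:=\prod_{i=0}^s(\sigma^i(a))^{c_i}$; in particular $a^{x}=\sigma(a)$ and $a^0=1$. A $\sigma$-ideal of $R$ is an ideal $I$ with $\sigma(I)\subseteq I$. A $\sigma$-ideal $I$ is well-mixed if $ab\in I$ implies $a\,\sigma(b)\in I$ for all $a,b\in R$; it is radical if it is a radical ideal in the usual sense. For $F\subseteq R$, $\langle F\rangle_r$ denotes the smallest radical well-mixed $\sigma$-ideal containing $F$. $K\{y_1,\ldots,y_n\}$ is the $\sigma$-polynomial ring: the polynomial ring over $K$ in the variables $y_i^{x^j}$ ($1\le i\le n$, $j\in\mathbb{N}$), with $\sigma$ extending that of $K$ and $\sigma(y_i^{x^j})=y_i^{x^{j+1}}$. For $\mathbf{f}=(f_1,\ldots,f_n)\in\mathbb{N}[x]^n$, $\mathbb{Y}^{\mathbf{f}}:=\prod_{i=1}^n y_i^{f_i}$.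 A pure binomial is an element $\mathbb{Y}^{\mathbf{f}}-\mathbb{Y}^{\mathbf{g}}$ with $\mathbf{f},\mathbf{g}\in\mathbb{N}[x]^n$. A pure binomial $\sigma$-ideal is a $\sigma$-ideal generated (as a $\sigma$-ideal) by pure binomials. *)

(* Defs.v *)
From HB Require Import structures.
From mathcomp Require Import all_boot all_algebra.
From mathcomp Require Import finmap monalg.

Set Implicit Arguments.
Unset Strict Implicit.
Unset Printing Implicit Defensive.

Import GRing.Theory.
Local Open Scope ring_scope.

Section SigmaRing.
Variables (R : comPzRingType) (sigma : {rmorphism R -> R}).

Definition sigma_pow (a : R) (p : {poly nat}) : R :=
  \prod_(i < size p) iter i sigma a ^+ (p`_i)%R.

(* Subsets are Prop-valued and ideals need not be proper, unlike the boolean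
   ideals of ring_quotient. *)
Record is_ideal (I : R -> Prop) : Prop := IsIdeal {
  ideal0 : I 0;
  idealD : forall a b, I a -> I b -> I (a + b);
  idealMl : forall a b, I b -> I (a * b) }.

Definition sigma_ideal (I : R -> Prop) : Prop :=
  is_ideal I /\ forall a, I a -> I (sigma a).

Definition well_mixed (I : R -> Prop) : Prop :=
  forall a b, I (a * b) -> I (a * sigma b).

Definition radical_set (I : R -> Prop) : Prop :=
  forall a k, I (a ^+ k) -> I a.

Definition radical_well_mixed (I : R -> Prop) : Prop :=
  [/\ sigma_ideal I, well_mixed I & radical_set I].

Definition sigma_span (F : R -> Prop) (a : R) : Prop :=
  forall J, sigma_ideal J -> (forall b, F b -> J b) -> J a.

Definition rwm_span (F : R -> Prop) (a : R) : Prop :=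
  forall J, radical_well_mixed J -> (forall b, F b -> J b) -> J a.

Lemma sigma_spanP F : sigma_ideal (sigma_span F).
Proof.
split; first split.
- by move=> J [[]].
- by move=> a b Ia Ib J JI FJ; apply: idealD JI.1 _ _ (Ia J JI FJ) (Ib J JI FJ).
- by move=> a b Ib J JI FJ; apply: idealMl JI.1 _ _ (Ib J JI FJ).
- by move=> a Ia J JI FJ; apply: JI.2; apply: Ia.
Qed.

Lemma rwm_spanP F : radical_well_mixed (rwm_span F).
Proof.
split; [split; first split | |].
- by move=> J [[[]]].
- move=> a b Ia Ib J JI FJ; have [[JJ _] _ _] := JI.
  exact: idealD JJ _ _ (Ia J JI FJ) (Ib J JI FJ).
- move=> a b Ib J JI FJ; have [[JJ _] _ _] := JI.
  exact: idealMl JJ _ _ (Ib J JI FJ).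
- by move=> a Ia J JI FJ; have [[_ Js] _ _] := JI; apply: Js; apply: Ia.
- by move=> a b Iab J JI FJ; have [_ Jm _] := JI; apply: Jm; apply: Iab.
- by move=> a k Ia J JI FJ; have [_ _ Jr] := JI; apply: (Jr a k); apply: Ia.
Qed.

End SigmaRing.

(* The pair (i, j) stands for the variable y_i^{x^j}. *)
Notation sigma_polynomial K n := {malg K[{cmonom ('I_n * nat)%type}]}.

Section SigmaPolynomial.
Variables (K : fieldType) (sigma : {rmorphism K -> K}) (n : nat).
Local Notation R := (sigma_polynomial K n).

Definition sigma_var (i : 'I_n) (j : nat) : R := << ucm (i, j) >>.

Definition shift_monom (m : {cmonom ('I_n * nat)%type}) : R :=
  \prod_(v <- finsupp m) sigma_var v.1 v.2.+1 ^+ m v.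

Lemma shift_monomEw (d : {fset ('I_n * nat)%type}) (m : {cmonom ('I_n * nat)%type}) :
  (finsupp m `<=` d)%fset ->
  shift_monom m = \prod_(v <- d) sigma_var v.1 v.2.+1 ^+ m v.
Proof.
move=> le_md; rewrite /shift_monom (big_fset_incl _ le_md) // => v _ vm.
by rewrite (fsfun_dflt vm) expr0.
Qed.

Lemma shift_monom_mmorphism : mmorphism shift_monom.
Proof.
split=> [m1 m2|]; last first.
  by rewrite /shift_monom mdom1 big_seq_fset0.
rewrite (@shift_monomEw (finsupp m1 `|` finsupp m2)%fset (mmul m1 m2)); last first.
  by rewrite mdomD.
rewrite (shift_monomEw (fsubsetUl (finsupp m1) (finsupp m2))).
rewrite (shift_monomEw (fsubsetUr (finsupp m1) (finsupp m2))).
by rewrite -big_split /=; apply: eq_bigr => v _; rewrite cmM exprD.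
Qed.

HB.instance Definition _ :=
  isMultiplicative.Build _ _ shift_monom shift_monom_mmorphism.

Definition sigma_ext : {rmorphism R -> R} :=
  mmap (malgC \o sigma) shift_monom.

Lemma sigma_extC c : sigma_ext c%:MP = (sigma c)%:MP.
Proof. exact: mmapC. Qed.

Lemma sigma_ext_var i j : sigma_ext (sigma_var i j) = sigma_var i j.+1.
Proof.
rewrite /sigma_ext /= mmapU /= rmorph1 mul1r.
by rewrite /shift_monom mdomU big_seq_fset1 cmUU expr1.
Qed.

Definition sigma_monomial (f : 'I_n -> {poly nat}) : R :=
  \prod_(i < n) sigma_pow sigma_ext (sigma_var i 0) (f i).

Definition pure_binomial (p : R) : Prop :=
  exists f g : 'I_n -> {poly nat}, p = sigma_monomial f - sigma_monomial g.

Definition pure_binomial_sigma_ideal (I : R -> Prop) : Prop :=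
  exists2 B : R -> Prop, (forall b, B b -> pure_binomial b) &
    forall a, I a <-> sigma_span sigma_ext B a.

End SigmaPolynomial.

(* Main.v *)
(* A radical well-mixed sigma-ideal is an intersection of prime sigma-ideals, so
   it suffices to find a finite part of the given binomials such that every
   prime sigma-ideal containing that part contains all of them.

   For a prime sigma-ideal P the exponents u with Y^{u+} = Y^{u-} modulo P, taken
   over the variables outside P, form a lattice; it is stable under u |-> x u as
   long as the negative part of x u only involves variables outside P.  If no
   finite part works, take an ultrafilter U on the prime sigma-ideals that
   contains {P | b in P} for each binomial b and such that U-almost no P contains
   all the binomials.  Let L be the set of exponents lying in the lattice of
   U-almost every P.  The key point is that U-almost every P satisfies: each u in
   L whose negative part avoids P lies in the lattice of P; this forces all the
   binomials into P, a contradiction.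

   To prove it, let t_i(P) be the least j with y_i^{x^j} in P (possibly infinite).
   The i with t_i almost constant contribute finitely many exponents, handled by
   finite generation of subgroups of Z^m.  The other i are treated in blocks on
   which the differences of the t_i are almost constant, slowest first: inside a
   block the top coefficients form a finitely generated group, and a top
   coefficient that could leave the bounds of P would have to be nonnegative,
   which is impossible since then no shift would ever leave the bounds. *)

Require Import Defs.
From mathcomp Require Import boolp classical_sets filter.
From mathcomp Require Import all_boot all_order all_algebra.
From mathcomp Require Import finmap monalg.
From mathcomp Require Import zify ring.

Set Implicit Arguments.
Unset Strict Implicit.
Unset Printing Implicit Defensive.

Import Order.TTheory GRing.Theory Num.Theory.
Local Open Scope ring_scope.

(** * Subgroups of finite rank *)

Section Subgroups.
Variable G : zmodType.
Implicit Types (H : G -> Prop) (u v w : G) (g : seq G).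

Definition subgroup H : Prop := H 0 /\ forall u v, H u -> H v -> H (u - v).

Definition zspan g u : Prop :=
  forall H, subgroup H -> (forall x, x \in g -> H x) -> H u.

Lemma zspan_subgroup g : subgroup (zspan g).
Proof.
split=> [H [] //|u v gu gv H HH gH].
by apply: HH.2; [apply: gu | apply: gv].
Qed.

Lemma mem_zspan g u : u \in g -> zspan g u.
Proof. by move=> ug H _; apply. Qed.

Lemma subgroupN H u : subgroup H -> H u -> H (- u).
Proof. by move=> [H0 HB] Hu; rewrite -sub0r; apply: HB. Qed.

Lemma subgroupD H u v : subgroup H -> H u -> H v -> H (u + v).
Proof.
by move=> HH Hu Hv; rewrite -[v]opprK; apply: HH.2 => //; apply: subgroupN.
Qed.

Lemma subgroupMz H u (k : int) : subgroup H -> H u -> H (u *~ k).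
Proof.
move=> HH Hu; have Hn m : H (u *+ m).
  by elim: m => [|m IH]; rewrite ?mulr0n ?mulrS; [exact: HH.1 | exact: subgroupD].
by case: k => m; rewrite ?NegzE ?mulrNz -pmulrn //; apply: subgroupN.
Qed.

Variables (I : eqType) (c : I -> G -> int).
Hypothesis cB : forall i u v, c i (u - v) = c i u - c i v.

Lemma coord0 i : c i 0 = 0.
Proof. by have := cB i 0 0; rewrite subrr addrN. Qed.

Lemma coordN i u : c i (- u) = - c i u.
Proof. by rewrite -sub0r cB coord0 sub0r. Qed.

Lemma coordD i u v : c i (u + v) = c i u + c i v.
Proof. by rewrite -{1}[v]opprK cB coordN opprK. Qed.

Lemma coordMz i u (k : int) : c i (u *~ k) = c i u * k.
Proof.
have Hn m : c i (u *+ m) = c i u * m%:Z.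
  by elim: m => [|m IH]; rewrite ?mulr0n ?coord0 ?mulr0 // mulrS coordD IH; lia.
by case: k => m; rewrite ?NegzE ?mulrNz -pmulrn ?coordN Hn //; lia.
Qed.

(** The image of [H] under [c i] is a subgroup of the integers, hence cyclic: [a] realises the least
    positive value, or is 0 if there is none. *)
Lemma principal_coord H i : subgroup H ->
  exists2 a, H a & forall u, H u -> exists k : int, c i u = c i (a *~ k).
Proof.
move=> HH.
have [[u [Hu cu]]|no] := pselect (exists u, H u /\ 0 < c i u); last first.
  exists 0; first exact: HH.1.
  move=> u Hu; exists 0; rewrite mulr0z coord0.
  have [cp|cn|//] := ltgtP (c i u) 0; last by case: no; exists u.
  by case: no; exists (- u); rewrite coordN oppr_gt0; split=> //; apply: subgroupN.
pose p m := `[< exists v, H v /\ c i v = m.+1%:Z >].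
have ex : exists m, p m.
  exists (`|c i u|.-1)%N; apply/asboolP; exists u; split=> //; lia.
case: (ex_minnP ex) => m /asboolP[a [Ha ca]] mmin.
exists a => // v Hv; exists (c i v %/ m.+1%:Z)%Z.
rewrite coordMz ca; set q := divz _ _.
have Hw : H (v - a *~ q) by apply: HH.2 => //; apply: subgroupMz.
have cw : c i (v - a *~ q) = modz (c i v) m.+1%:Z.
  by rewrite cB coordMz ca {1}(divz_eq (c i v) m.+1%:Z) -/q; lia.
have r0 : 0 <= modz (c i v) m.+1%:Z by apply: modz_ge0.
have rm : modz (c i v) m.+1%:Z < m.+1%:Z by apply: ltz_pmod.
have [rp|] := boolP (0 < modz (c i v) m.+1%:Z).
  have /mmin : p (`|modz (c i v) m.+1%:Z|.-1)%N.
    by apply/asboolP; exists (v - a *~ q); split=> //; rewrite cw; lia.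
  by lia.
by rewrite {2}(divz_eq (c i v) m.+1%:Z) -/q; lia.
Qed.

(** Induction on [s]: a multiple of a principal element clears the first coordinate, and the rest
    happens in the kernel of that coordinate. Agreement is asked only on [s], since [G] may have
    infinite rank. *)
Lemma subgroup_fg H (s : seq I) : subgroup H ->
  exists2 g, (forall x, x \in g -> H x) &
    forall u, H u -> exists2 w, zspan g w & forall i, i \in s -> c i u = c i w.
Proof.
elim: s H => [|i s IH] H HH.
  by exists [::] => // u _; exists 0 => //; apply: (zspan_subgroup _).1.
have HH' : subgroup (fun u => H u /\ c i u = 0).
  split=> [|u v [Hu u0] [Hv v0]]; first by split; [exact: HH.1 | exact: coord0].
  by split; [exact: HH.2 | rewrite cB u0 v0].
have [g gH gP] := IH _ HH'.
have [a Ha aP] := principal_coord i HH.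
exists (a :: g) => [x|u Hu].
  by rewrite inE => /predU1P[->//|/gH[]].
have [k ck] := aP u Hu.
have [|w gw cw] := gP (u - a *~ k).
  by split; [apply: HH.2 => //; apply: subgroupMz | rewrite cB ck subrr].
have gi : c i w = 0.
  have [] // := gw (fun u => H u /\ c i u = 0) HH' gH.
exists (a *~ k + w) => [|j].
  apply: (subgroupD (zspan_subgroup _)).
    by apply: (subgroupMz _ (zspan_subgroup _)); apply: mem_zspan; rewrite mem_head.
  by move=> L LL agL; apply: gw => // x xg; apply: agL; rewrite inE xg orbT.
rewrite inE => /predU1P[->|/cw]; first by rewrite coordD gi addr0.
by rewrite cB coordD; lia.
Qed.

End Subgroups.

(** * Limits of exponent lattices along an ultrafilter *)

Lemma filter_all_seq (T : Type) (F : set_system T) (FF : Filter F)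
    (I : eqType) (s : seq I) (Q : I -> T -> Prop) :
  (forall x, x \in s -> F (Q x)) -> F (fun P => forall x, x \in s -> Q x P).
Proof.
elim: s => [|x s IH] sQ; first by apply: filterS filterT.
have sF : F (fun P => forall y, y \in s -> Q y P).
  by apply: IH => y ys; apply: sQ; rewrite inE ys orbT.
apply: filterS (filterI (sQ x (mem_head _ _)) sF) => P [Qx Qs] y.
by rewrite inE => /predU1P[->|/Qs].
Qed.

(** * Integer exponent vectors and multiplication by x *)

Section Shift.
Variable n : nat.
Local Notation V := {ffun 'I_n -> {poly int}}.
Implicit Types (u v w : V) (i : 'I_n) (j : nat).

Definition shift u : V := [ffun i => u i * 'X].

Definition expo (p : 'I_n * nat) u : int := (u p.1)`_p.2.

Lemma expoB p u v : expo p (u - v) = expo p u - expo p v.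
Proof. by rewrite /expo !ffunE coefB. Qed.

Lemma expo_shift i j u : expo (i, j.+1) (shift u) = expo (i, j) u.
Proof. by rewrite /expo ffunE coefMX. Qed.

Lemma expo_shift0 i u : expo (i, 0%N) (shift u) = 0.
Proof. by rewrite /expo ffunE coefMX. Qed.

Lemma expo_iter_shift i j k u :
  expo (i, j) (iter k shift u) = if (j < k)%N then 0 else expo (i, (j - k)%N) u.
Proof.
elim: k j => [|k IH] [|j] //=; first by rewrite expo_shift0.
by rewrite expo_shift IH subSS ltnS.
Qed.

Lemma expo_eq0 u : (forall i j, expo (i, j) u = 0) -> u = 0.
Proof. by move=> u0; apply/ffunP => i; apply/polyP => j; rewrite ffunE coef0; exact: u0. Qed.

Lemma expo_bounded u : exists m, forall i j, (m <= j)%N -> expo (i, j) u = 0.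
Proof.
exists (\max_i size (u i))%N => i j mj; rewrite /expo nth_default //=.
by apply: leq_trans mj; apply: (leq_bigmax i).
Qed.

Definition in_bounds (inb : 'I_n -> nat -> Prop) u : Prop :=
  forall i j, expo (i, j) u <> 0 -> inb i j.

Definition neg_in_bounds (inb : 'I_n -> nat -> Prop) u : Prop :=
  forall i j, expo (i, j) u < 0 -> inb i j.

Lemma in_bounds_neg inb u : in_bounds inb u -> neg_in_bounds inb u.
Proof. by move=> uin i j uij; apply: uin => u0; rewrite u0 ltxx in uij. Qed.

Lemma neg_in_boundsB inb u v :
  neg_in_bounds inb u -> in_bounds inb v -> neg_in_bounds inb (u - v).
Proof.
move=> uin vin i j; rewrite expoB => uvij.
have [v0|/eqP vn0] := eqVneq (expo (i, j) v) 0; last exact: vin.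
by apply: uin; rewrite v0 subr0 in uvij.
Qed.

End Shift.

Section LimitLattice.
Variables (n : nat) (T : Type) (U : set_system T) (UU : UltraFilter U).
Local Notation V := {ffun 'I_n -> {poly int}}.
Variables (inb : T -> 'I_n -> nat -> Prop) (Lam : T -> V -> Prop).
Implicit Types (P : T) (u v w : V) (i : 'I_n) (j : nat) (N : V -> Prop).

Hypothesis inbS : forall P i j, inb P i j.+1 -> inb P i j.
Hypothesis LamG : forall P, subgroup (Lam P).
Hypothesis Lam_in : forall P u, Lam P u -> in_bounds (inb P) u.
Hypothesis LamX : forall P u,
  Lam P u -> neg_in_bounds (inb P) (shift u) -> Lam P (shift u).

Let UF : Filter U.
Proof. exact: filter_filter. Qed.

Let UN0 : ~ U (fun=> False).
Proof. exact: filter_not_empty. Qed.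

Lemma inb_le P i j k : (j <= k)%N -> inb P i k -> inb P i j.
Proof.
move=> /subnK <-; elim: (k - j)%N => [|m IH] //.
by rewrite addSn => /inbS.
Qed.

Definition LamU u : Prop := U (fun P => Lam P u).

(** The quantifier over [u] stands inside [U]: one member of the ultrafilter serves all [u] at once,
    whereas in [LamU] it may depend on [u]. *)
Definition eventually_full N : Prop :=
  U (fun P => forall u, N u -> neg_in_bounds (inb P) u -> Lam P u).

Lemma LamU_subgroup : subgroup LamU.
Proof.
split=> [|u v Uu Uv]; first by apply: filterS filterT => P _; exact: (LamG P).1.
by apply: filterS (filterI (Uu : U _) Uv) => P [Pu Pv]; apply: (LamG P).2.
Qed.

Lemma LamU_seq (g : seq V) : (forall x, x \in g -> LamU x) ->
  U (fun P => forall w, zspan g w -> Lam P w).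
Proof.
move=> gU; apply: filterS (filter_all_seq UF gU) => P gP w gw.
exact: (gw (Lam P) (LamG P) gP).
Qed.

(** Elements of [N] are corrected on the finite set [s] by the span of finitely many generators,
    which lies in almost every [Lam P]. Such a correction is in bounds, so the negative part stays
    in bounds. *)
Lemma eventually_full_coords N (s : seq ('I_n * nat)) :
  subgroup N -> (forall u, N u -> LamU u) ->
  eventually_full (fun u => N u /\ forall p, p \in s -> expo p u = 0) ->
  eventually_full N.
Proof.
move=> NG NU full.
have [g gN gP] := subgroup_fg (@expoB n) s NG.
have gU x : x \in g -> LamU x by move/gN/NU.
rewrite /eventually_full.
apply: filterS (filterI (full : U _) (LamU_seq gU)) => P [Pfull Pg] u Nu uneg.
have [w gw cw] := gP u Nu.
have Pw := Pg w gw.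
have Nw := gw N NG gN.
rewrite -[u](subrK w); apply: (subgroupD (LamG P) _ Pw); apply: Pfull.
  by split=> [|p ps]; [exact: NG.2 | rewrite expoB cw // subrr].
exact: neg_in_boundsB (Lam_in Pw).
Qed.

(** * A block of indices whose bounds move together *)

Section Block.
Variables (N : V -> Prop) (S D : {set 'I_n}) (i0 : 'I_n) (o : 'I_n -> nat).
Hypothesis NG : subgroup N.
Hypothesis NU : forall u, N u -> LamU u.
Hypothesis NX : forall u, N u -> N (shift u).
Hypothesis NS : forall u i j, N u -> i \notin S -> expo (i, j) u = 0.
Hypothesis D_offset : forall i, i \in D ->
  U (fun P => forall d, inb P i (d + o i) <-> inb P i0 d).
Hypothesis D_far : forall i m, i \in S -> i \notin D ->
  U (fun P => forall d, inb P i0 d -> inb P i (d + m)).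

(** Degrees inside [D] are measured on the scale of [i0], after subtracting the offsets [o]. *)
Let level d u : Prop := forall i j, i \in D -> (d + o i < j)%N -> expo (i, j) u = 0.

Let top d u : {ffun 'I_n -> int} :=
  [ffun i => if i \in D then expo (i, (d + o i)%N) u else 0].

Let topE d u i : i \in D -> top d u i = expo (i, (d + o i)%N) u.
Proof. by rewrite ffunE => ->. Qed.

Let topB d u v : top d (u - v) = top d u - top d v.
Proof. by apply/ffunP => i; rewrite !ffunE; case: ifP; rewrite ?expoB ?subrr. Qed.

Let iterN k u : N u -> N (iter k (@shift n) u).
Proof. by move=> Nu; elim: k => //= k; apply: NX. Qed.

Let iter_level k d u : level d u -> level (d + k) (iter k (@shift n) u).
Proof.
move=> du i j iD dj; rewrite expo_iter_shift; case: ltnP => // kj.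
by apply: du => //; lia.
Qed.

Let iter_top k d u : top (d + k) (iter k (@shift n) u) = top d u.
Proof.
apply/ffunP => i; rewrite !ffunE; case: ifP => // iD.
rewrite expo_iter_shift ifF; last by lia.
by congr (expo (_, _) _); lia.
Qed.

Let level_subgroup d : subgroup (fun u => N u /\ level d u).
Proof.
split=> [|u v [Nu du] [Nv dv]].
  by split=> [|i j _ _]; [exact: NG.1 | rewrite /expo ffunE coef0].
split=> [|i j iD dj]; first exact: NG.2.
by rewrite expoB du // dv // subrr.
Qed.

Let tops (a : {ffun 'I_n -> int}) : Prop := exists d u, [/\ N u, level d u & top d u = a].

(** Shifting raises the level and keeps the top, so two elements can be brought to the common level
    [d + e] before subtracting. *)
Let tops_subgroup : subgroup tops.
Proof.
split=> [|_ _ [d [u [Nu du <-]]] [e [v [Nv ev <-]]]].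
  exists 0%N, 0; split; [exact: NG.1 | exact: (level_subgroup 0).1.2 |].
  by apply/ffunP => i; rewrite !ffunE /expo ffunE coef0 if_same.
exists (d + e)%N, (iter e (@shift n) u - iter d (@shift n) v).
have [] := (level_subgroup (d + e)).2 (iter e (@shift n) u) (iter d (@shift n) v).
- by split; [exact: iterN | exact: iter_level].
- by split; [exact: iterN | rewrite addnC; exact: iter_level].
move=> Nuv luv; split=> //.
by rewrite topB iter_top addnC iter_top.
Qed.

(* The top coefficients form a finitely generated group, so all of them are
   already attained in one bounded level. *)
Let tops_generators : exists d0 (ws : seq V),
  (forall w, w \in ws -> N w /\ level d0 w) /\
  (forall d u, N u -> level d u -> exists2 w, zspan ws w & top d0 w = top d u).
Proof.
have cB i (a b : {ffun 'I_n -> int}) : (a - b) i = a i - b i by rewrite !ffunE.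
have [g gT gP] := subgroup_fg cB (enum 'I_n) tops_subgroup.
have [d0 d0P] : exists d0, forall x, x \in g ->
    exists u, [/\ N u, level d0 u & top d0 u = x].
  elim: g gT {gP} => [|x g IH] gT; first by exists 0%N.
  have [|d dP] := IH; first by move=> y yg; apply: gT; rewrite inE yg orbT.
  have [e [u [Nu eu tu]]] := gT x (mem_head _ _).
  exists (d + e)%N => y; rewrite inE => /predU1P[->|/dP[v [Nv dv tv]]].
    exists (iter d (@shift n) u); rewrite addnC.
    by split; [exact: iterN | exact: iter_level | rewrite iter_top].
  exists (iter e (@shift n) v).
  by split; [exact: iterN | exact: iter_level | rewrite iter_top].
have [ws wsN wsP] : exists2 ws : seq V, (forall w, w \in ws -> N w /\ level d0 w) &
    forall x, x \in g -> exists2 w, w \in ws & top d0 w = x.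
  elim: g d0P {gT gP} => [|x g IH] gT; first by exists [::].
  have [|ws wsN wsP] := IH; first by move=> y yg; apply: gT; rewrite inE yg orbT.
  have [u [Nu du tu]] := gT x (mem_head _ _).
  exists (u :: ws) => y; rewrite inE => /predU1P[->|].
  - by [].
  - exact: wsN.
  - by exists u; rewrite ?mem_head.
  - by move=> /wsP[w wws tw]; exists w; rewrite // inE wws orbT.
exists d0, ws; split=> // d u Nu du.
have [|a ga ua] := gP (top d u); first by exists d, u.
have -> : top d u = a by apply/ffunP => i; apply: ua; rewrite mem_enum.
apply: (ga (fun a => exists2 w, zspan ws w & top d0 w = a)).
  split=> [|_ _ [w ww <-] [w' ww' <-]].
    exists 0; first exact: (zspan_subgroup _).1.
    by apply/ffunP => i; rewrite !ffunE /expo ffunE coef0 if_same.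
  by exists (w - w'); [exact: (zspan_subgroup _).2 | rewrite topB].
by move=> x /wsP[w wws tw]; exists w => //; apply: mem_zspan.
Qed.

(** Descent on the level: the top of [u] is that of some [w] in the span of [ws], and subtracting a
    shift of [w] lowers the level. Once the level is at most [d0], only finitely many block
    coordinates remain. *)
Lemma eventually_full_block :
  eventually_full (fun u => N u /\ forall i j, i \in D -> expo (i, j) u = 0) ->
  eventually_full N.
Proof.
move=> full.
have [d0 [ws [wsN wsP]]] := tops_generators.
(* This [m] is the margin by which the indices of [S] outside the block must outlast [i0]. *)
have [m wsm] : exists m, forall w, w \in ws -> forall i j, (m <= j)%N -> expo (i, j) w = 0.
  elim: (ws) => [|w s [m mP]]; first by exists 0%N.
  have [k kP] := expo_bounded w.
  exists (m + k)%N => v; rewrite inE => /predU1P[->|/mP vm] i j mkj.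
    by apply: kP; lia.
  by apply: vm; lia.
have low : eventually_full (fun u => N u /\ level d0 u).
  pose s := [seq (i, j) | i <- enum D, j <- iota 0 (d0 + \max_i o i).+1].
  apply: (@eventually_full_coords _ s) => //; first by move=> u [/NU].
  rewrite /eventually_full; apply: filterS (full : U _) => P Pfull u [[Nu du] us].
  apply: Pfull; split=> // i j iD.
  have [ji|] := leqP j (d0 + o i); last exact: du.
  apply: us; apply/allpairsP; exists (i, j); split; rewrite ?mem_enum ?mem_iota //.
  rewrite add0n /= ltnS; apply: (leq_trans ji); rewrite leq_add2l.
  exact: (leq_bigmax i).
have wsU : U (fun P => forall w, zspan ws w -> Lam P w).
  by apply: LamU_seq => w /wsN[/NU].
have offU : U (fun P => forall i, i \in enum D ->
    forall d, inb P i (d + o i) <-> inb P i0 d).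
  by apply: filter_all_seq => i; rewrite mem_enum; apply: D_offset.
have farU : U (fun P => forall i, i \in enum (S :\: D) ->
    forall d, inb P i0 d -> inb P i (d + m)).
  by apply: filter_all_seq => i; rewrite mem_enum inE => /andP[? ?]; apply: D_far.
rewrite /eventually_full.
apply: filterS (filterI (filterI (low : U _) wsU) (filterI offU farU)).
move=> P [[Plow Pws] [Poff' Pfar']].
have Poff i d : i \in D -> inb P i (d + o i) <-> inb P i0 d.
  by move=> iD; apply: Poff'; rewrite mem_enum.
have Pfar i d : i \in S -> i \notin D -> inb P i0 d -> inb P i (d + m).
  by move=> iS iD; apply: Pfar'; rewrite mem_enum inE iS iD.
have spanN w : zspan ws w -> N w /\ level d0 w.
  by move=> /(_ _ (level_subgroup d0)); apply.
have spanm w i j : zspan ws w -> (m <= j)%N -> expo (i, j) w = 0.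
  move=> ww mj; apply: (ww (fun w => expo (i, j) w = 0)) => [|v /wsm]; last exact.
  split=> [|u v u0 v0]; first by rewrite /expo ffunE coef0.
  by rewrite expoB u0 v0 subrr.
(* In the block, a shift by [k] reaches level [d0 + k] at most; off the block it stays in degrees
   below [k + m], which [Pfar] covers. *)
have supp_shift w k i j : zspan ws w -> inb P i0 (d0 + k) ->
    expo (i, j) (iter k (@shift n) w) <> 0 -> inb P i j.
  move=> ww ink; have [Nw dw] := spanN w ww.
  have [iS|iS] := boolP (i \in S); last by rewrite NS //; exact: iterN.
  have [iD|iD] := boolP (i \in D).
    have [ji _|ji] := leqP j (d0 + k + o i); last by rewrite (iter_level dw).
    by apply: inb_le ji _; apply/Poff.
  rewrite expo_iter_shift; case: ltnP => // kj nz.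
  have mj : (j - k < m)%N by rewrite ltnNge; apply/negP => mj; apply: nz; apply: spanm.
  by apply: (@inb_le P i j (d0 + k + m)); [lia | apply: Pfar].
have shift_Lam w k : zspan ws w -> inb P i0 (d0 + k) -> Lam P (iter k (@shift n) w).
  move=> ww; elim: k => [_|k IH ink]; first exact: Pws.
  rewrite iterS; apply: LamX; first by apply: IH; apply: inb_le ink; lia.
  by apply: in_bounds_neg => i j; rewrite -iterS; apply: supp_shift.
(* If the tops of [w] are nonnegative and nonzero then every shift of [w] lies
   in the lattice, so the block is never left. *)
have nonneg_top w i : zspan ws w -> (forall i', 0 <= top d0 w i') -> top d0 w i <> 0 ->
    forall k, inb P i0 (d0 + k).
  move=> ww w_ge0 wi k.
  have iD : i \in D by move: wi; rewrite ffunE; case: ifP.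
  suff : Lam P (iter k (@shift n) w).
    move=> /Lam_in/(_ i (d0 + k + o i)%N) wk; apply/(Poff i) => //; apply: wk.
    by rewrite -topE // iter_top.
  elim: k => [|k IH]; first exact: Pws.
  have ink : inb P i0 (d0 + k).
    apply/(Poff i) => //; apply: (Lam_in IH).
    by rewrite -topE // iter_top.
  rewrite iterS; apply: LamX => // i' [|j']; first by rewrite expo_shift0 ltxx.
  have [Nw dw] := spanN w ww.
  rewrite expo_shift => neg.
  have [iD'|iD'] := boolP (i' \in D).
    have [j'i'|] := ltnP j' (d0 + k + o i'); first by apply: inb_le j'i' _; apply/Poff.
    rewrite leq_eqVlt => /predU1P[j'i'|j'i']; last by move: neg; rewrite (iter_level dw).
    by have := w_ge0 i'; rewrite -(iter_top k) topE // j'i' leNgt neg.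
  have [iS|iS] := boolP (i' \in S); last first.
    by move: neg; rewrite NS ?ltxx //; exact: iterN.
  apply: (@inb_le P i' j'.+1 (d0 + k + m)); last exact: Pfar.
  rewrite leqNgt; apply/negP => mj; move: neg; rewrite expo_iter_shift.
  by case: ltnP => // kj; rewrite spanm //; lia.
suff main k u : N u -> level (d0 + k) u -> neg_in_bounds (inb P) u -> Lam P u.
  move=> u Nu; have [k uk] := expo_bounded u; apply: (main k) => // i j _ ij.
  by apply: uk; lia.
elim: k u => [|k IH] u Nu; first by rewrite addn0 => du; apply: Plow.
move=> du uneg; have [w ww tw] := wsP _ _ Nu du.
have [Nw dw] := spanN w ww.
have [u0|/existsNP[i wi]] := pselect (forall i, top d0 w i = 0).
  apply: IH => // i j iD ij.
  have [ji|] := ltnP (d0 + k.+1 + o i) j; first exact: du.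
  move=> ji; have -> : j = (d0 + k.+1 + o i)%N by lia.
  by rewrite -topE // -tw.
(* If this failed, [u] could have no negative entry at the top, so the top of [w] would be
   nonnegative and nonzero, and [nonneg_top] would give the bound after all. *)
have ink : inb P i0 (d0 + k.+1).
  apply: contrapT => nin; apply: (nin); apply: (nonneg_top w i) => // i'.
  rewrite tw ffunE; case: ifP => // iD.
  by rewrite leNgt; apply/negP => /uneg /(Poff _ _ iD).
have Pw := shift_Lam w k.+1 ww ink.
rewrite -[u](subrK (iter k.+1 (@shift n) w)); apply: (subgroupD (LamG P) _ Pw).
apply: IH; first by apply: NG.2 => //; exact: iterN.
  move=> i' j iD ij; rewrite expoB.
  have [ji|ji] := ltnP (d0 + k.+1 + o i') j.
    by rewrite du // (iter_level dw) // subrr.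
  have -> : j = (d0 + k.+1 + o i')%N by lia.
  by rewrite -!topE // iter_top tw subrr.
exact: neg_in_boundsB (Lam_in Pw).
Qed.
End Block.

Lemma ultra_or (Q Q' : T -> Prop) : U (fun P => Q P \/ Q' P) -> U Q \/ U Q'.
Proof.
move=> UQ; have [|UnQ] := in_ultra_setVsetC Q UU; first by left.
by right; apply: filterS (filterI UQ UnQ) => P [[]].
Qed.

Lemma ultra_not (Q : T -> Prop) : ~ U Q -> U (fun P => ~ Q P).
Proof. by move=> nQ; have [] := in_ultra_setVsetC Q UU. Qed.

(** For each [P] the sets [inb P i] are initial segments, hence comparable; the ultrafilter decides
    each comparison. *)
Lemma slowest_index (s : seq 'I_n) (i1 : 'I_n) :
  exists2 i0, i0 \in i1 :: s &
    forall i, i \in i1 :: s -> U (fun P => forall d, inb P i0 d -> inb P i d).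
Proof.
elim: s => [|i2 s [i0 i0s i0P]].
  exists i1; first exact: mem_head.
  by move=> i; rewrite inE => /eqP->; apply: filterS filterT.
have : U (fun P => (forall d, inb P i0 d -> inb P i2 d) \/
                   (forall d, inb P i2 d -> inb P i0 d)).
  apply: filterS filterT => P _.
  have [|/existsNP[d nd]] := pselect (forall d, inb P i0 d -> inb P i2 d); first by left.
  move/not_implyP: nd => [in0 nin2]; right=> e in2.
  by apply: inb_le in0; rewrite leqNgt; apply/negP => ed; apply: nin2; apply: inb_le in2; lia.
case/ultra_or => Ui.
  exists i0; first by move: i0s; rewrite !inE => /orP[->//|->]; rewrite !orbT.
  move=> i; rewrite !inE => /or3P[/eqP->|/eqP->//|si]; apply: i0P; rewrite ?mem_head //.
  by rewrite inE si orbT.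
exists i2; first by rewrite !inE eqxx orbT.
move=> i; rewrite !inE => ii; have [->|ni] := eqVneq i i2; first exact: filterS filterT.
have /i0P Ui0 : i \in i1 :: s by rewrite inE; case/or3P: ii ni => ->; rewrite ?orbT.
by apply: filterS (filterI Ui Ui0) => P [P2 P0] d /P2/P0.
Qed.

(** If the second alternative holds for [m] but fails for [m.+1], then for almost every [P] the
    segment of [i] ends exactly [m] after that of [i0]. *)
Lemma offset_or_far (i0 i : 'I_n) :
  U (fun P => forall d, inb P i0 d -> inb P i d) ->
  (exists o, U (fun P => forall d, inb P i (d + o) <-> inb P i0 d)) \/
  (forall m, U (fun P => forall d, inb P i0 d -> inb P i (d + m))).
Proof.
move=> Ui; have [|/existsNP[m b]] :=
  pselect (forall m, U (fun P => forall d, inb P i0 d -> inb P i (d + m))); first by right.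
left; elim: m b => [|m IH] b; first by case: b; apply: filterS Ui => P Pi d /Pi; rewrite addn0.
have [Um|/IH//] := pselect (U (fun P => forall d, inb P i0 d -> inb P i (d + m))).
exists m; apply: filterS (filterI Um (ultra_not b)) => P [Pm /existsNP[d nd]] e.
split; last exact: Pm.
move/not_implyP: nd => [in0 nin] ine; apply: inb_le in0.
by rewrite leqNgt; apply/negP => de; apply: nin; apply: inb_le ine; lia.
Qed.

Let supported (S : {set 'I_n}) u : Prop :=
  LamU u /\ forall i j, i \notin S -> expo (i, j) u = 0.

(** Induction on the size of [S]: the indices at constant offset from the slowest one form the block
    [D], which contains that index, so [S :\: D] is smaller. *)
Lemma eventually_full_supported (S : {set 'I_n}) :
  (forall i d, i \in S -> U (fun P => inb P i d)) -> eventually_full (supported S).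
Proof.
have [k] := ubnP #|S|; elim: k S => // k IH S Sk Sin.
have [->|/set0Pn[i1 i1S]] := eqVneq S set0.
  rewrite /eventually_full; apply: filterS filterT => P _ u [_ u0] _.
  by rewrite (@expo_eq0 _ u) => [|i j]; [exact: (LamG P).1 | rewrite u0 ?inE].
have [i0 i0S' i0P] := slowest_index (enum S) i1.
have i0S : i0 \in S by move: i0S'; rewrite inE mem_enum => /predU1P[->|].
have Si0 i : i \in S -> U (fun P => forall d, inb P i0 d -> inb P i d).
  by move=> iS; apply: i0P; rewrite inE mem_enum iS orbT.
pose off i c := U (fun P => forall d, inb P i (d + c) <-> inb P i0 d).
pose D := [set i in S | `[< exists c, off i c >]].
have i0D : i0 \in D.
  rewrite inE i0S; apply/asboolP; exists 0%N; apply: filterS filterT => P _ d.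
  by rewrite addn0.
have [i|o oP] := choice (P := fun i c => i \in D -> off i c).
  have [|] := boolP (i \in D); last by exists 0%N.
  by rewrite inE => /andP[_ /asboolP[c ic]]; exists c.
apply: (@eventually_full_block (supported S) S D i0 o).
- split=> [|u v [Uu u0] [Uv v0]].
    by split=> [|i j _]; [exact: LamU_subgroup.1 | rewrite /expo ffunE coef0].
  split=> [|i j iS]; first exact: LamU_subgroup.2.
  by rewrite expoB u0 ?v0 ?subrr.
- by move=> u [].
(* Closure under [shift]: the support of [u] is finite, and on [S] the bounds of almost every [P] go
   beyond it. *)
- move=> u [Uu u0]; split=> [|i [|j] iS]; last 2 first.
  + exact: expo_shift0.
  + by rewrite expo_shift u0.
  have [m mP] := expo_bounded u.
  have Um : U (fun P => forall i, i \in enum S -> inb P i m).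
    by apply: filter_all_seq => i; rewrite mem_enum; apply: Sin.
  rewrite /LamU; apply: filterS (filterI (Uu : U _) Um) => P [Pu Pm]; apply: LamX => // i [|j].
    by rewrite expo_shift0 ltxx.
  rewrite expo_shift => neg.
  have [iS|/(u0 i j) u0'] := boolP (i \in S); last by rewrite u0' ltxx in neg.
  apply: (@inb_le P i j.+1 m); last by apply: Pm; rewrite mem_enum.
  by rewrite ltnNge; apply/negP => /(mP i) u0'; rewrite u0' ltxx in neg.
- by move=> u i j [_ u0] /u0.
- exact: oP.
- move=> i m iS iD; have [[c ic]|] := offset_or_far (Si0 i iS); last by [].
  by case/negP: iD; rewrite inE iS; apply/asboolP; exists c.
have full : eventually_full (supported (S :\: D)).
  apply: IH => [|i d]; last by rewrite inE => /andP[_ /Sin].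
  rewrite -ltnS; apply: leq_trans Sk; rewrite ltnS; apply: proper_card.
  apply/properP; split; first exact: subsetDl.
  by exists i0; rewrite // inE i0D.
rewrite /eventually_full.
apply: filterS (full : U _) => P Pfull u [[Uu u0] uD]; apply: Pfull; split=> // i j.
rewrite inE negb_and negbK => /orP[|]; [exact: uD | exact: u0].
Qed.

(** For indices outside [S], degree [m] is almost surely out of bounds, so elements of [LamU] vanish
    there from degree [m] on; the finitely many lower coordinates are cleared by
    [eventually_full_coords]. *)
Lemma eventually_full_LamU : eventually_full LamU.
Proof.
pose S := [set i | `[< forall d, U (fun P => inb P i d) >]].
have [m mP] : exists m, forall i, i \notin S -> U (fun P => ~ inb P i m).
  have [i|f fP] := choice (P := fun i d => i \notin S -> U (fun P => ~ inb P i d)).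
    have [_|] := boolP (i \in S); first by exists 0%N.
    rewrite inE => /asboolPn/existsNP[d nd].
    by exists d => _; apply: ultra_not.
  exists (\max_i f i)%N => i /fP; apply: filterS => P; apply: contra_not.
  by apply: inb_le; apply: (leq_bigmax i).
pose s := [seq (i, j) | i <- enum (~: S), j <- iota 0 m].
apply: (eventually_full_coords (s := s) LamU_subgroup) => //.
have Sin i d : i \in S -> U (fun P => inb P i d).
  by rewrite inE => /asboolP.
rewrite /eventually_full.
apply: filterS (eventually_full_supported Sin : U _) => P Pfull u [Uu us].
apply: Pfull; split=> // i j iS.
have [mj|jm] := leqP m j; last first.
  apply: (us (i, j)); apply/allpairsP; exists (i, j).
  by split; rewrite ?mem_enum ?mem_iota ?inE // in iS *.
apply/eqP/negP => /negP/eqP nz; apply: UN0.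
apply: filterS (filterI (Uu : U _) (mP i iS)) => Q [/Lam_in Qu]; apply.
by apply: inb_le mj _; apply: Qu.
Qed.

End LimitLattice.

(** * Prime sigma-ideals and their exponent lattices *)

Section PrimeSigmaIdeals.
Variables (R : comPzRingType) (sigma : {rmorphism R -> R}).
Implicit Types (J M P : R -> Prop) (a b c : R).

Record prime_sigma_ideal P : Prop := PrimeSigmaIdeal {
  prime_sigma : sigma_ideal sigma P;
  prime_proper : ~ P 1;
  primeM : forall a b, P (a * b) -> P a \/ P b }.

Lemma idealN P a : is_ideal P -> P a -> P (- a).
Proof. by move=> PI Pa; rewrite -mulN1r; apply: idealMl. Qed.

Lemma idealMr P a b : is_ideal P -> P a -> P (a * b).
Proof. by move=> PI Pa; rewrite mulrC; apply: idealMl. Qed.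

Lemma idealB P a b : is_ideal P -> P a -> P b -> P (a - b).
Proof. by move=> PI Pa Pb; apply: idealD => //; apply: idealN. Qed.

Lemma primeX P a k : prime_sigma_ideal P -> P (a ^+ k) -> P a.
Proof.
move=> PP; elim: k => [|k IH]; first by rewrite expr0 => /(prime_proper PP).
by rewrite exprS => /(primeM PP)[].
Qed.

Lemma prime_radical_well_mixed P : prime_sigma_ideal P -> radical_well_mixed sigma P.
Proof.
move=> PP; have [PI Ps] := prime_sigma PP.
split=> [|a b|a k]; [exact: prime_sigma | | exact: primeX].
move/(primeM PP)=> [Pa|/Ps Pb]; [exact: idealMr | exact: idealMl].
Qed.

(** Stability of the colon ideal under [sigma] comes from well-mixedness of [M]; for radicality, the
    power k+1 of ab is a multiple of a^k b. *)
Lemma rwm_colon M b : radical_well_mixed sigma M ->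
  radical_well_mixed sigma (fun r => M (r * b)).
Proof.
move=> [[MI Ms] Mm Mr]; split; first split; first split.
- by rewrite mul0r; exact: ideal0.
- by move=> a c Ma Mc; rewrite mulrDl; exact: idealD.
- by move=> a c Mc; rewrite -mulrA; exact: idealMl.
- by move=> a; rewrite mulrC => /Mm; rewrite mulrC.
- by move=> a c; rewrite mulrAC => /Mm; rewrite mulrAC.
- move=> a k Ma; apply: (Mr _ k.+1).
  have -> : (a * b) ^+ k.+1 = a * b ^+ k * (a ^+ k * b).
    by rewrite exprMn exprS exprSr; ring.
  exact: idealMl.
Qed.

Lemma rwm_chain_union (F : set (set R)) : (exists M, F M) ->
  (forall M, F M -> radical_well_mixed sigma M) -> total_on F classical_sets.subset ->
  radical_well_mixed sigma (fun a => exists2 M, F M & M a).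
Proof.
move=> [M0 FM0] Frwm Ftot; split; first split; first split.
- by exists M0 => //; have [[[]]] := Frwm _ FM0.
- move=> a b [M FM Ma] [N FN Nb].
  have [[[MI _] _ _] [[NI _] _ _]] := (Frwm _ FM, Frwm _ FN).
  by case: (Ftot _ _ FM FN) => [MN|NM]; [exists N | exists M] => //;
    apply: idealD => //; [exact: MN | exact: NM].
- by move=> a b [M FM Mb]; exists M => //; have [[MI _] _ _] := Frwm _ FM; exact: idealMl.
- by move=> a [M FM Ma]; exists M => //; have [[_ Ms] _ _] := Frwm _ FM; exact: Ms.
- by move=> a b [M FM Mab]; exists M => //; have [_ Mm _] := Frwm _ FM; exact: Mm.
- by move=> a k [M FM Ma]; exists M => //; have [_ _ Mr] := Frwm _ FM; exact: Mr Ma.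
Qed.

(** Let M be maximal among the radical well-mixed ideals containing [J] and avoiding [a]. For b
    outside M, the colon M : b is M or contains [a]; using this twice on a product bc in M with b
    and c outside M puts a^2 into M. *)
Lemma prime_avoiding J a : radical_well_mixed sigma J -> ~ J a ->
  exists P, [/\ prime_sigma_ideal P, forall b, J b -> P b & ~ P a].
Proof.
move=> JR nJa.
pose avoids (M : set R) := [/\ radical_well_mixed sigma M, J `<=` M & ~ M a]%classic.
have [F FP Ftot|M [Mav Mmax]] := @Zorn_bigcup R (fun M => M = classical_sets.set0 \/ avoids M).
  have [[M0 [FM0 av0]]|no] := pselect (exists M, F M /\ avoids M); last first.
    left; rewrite -classical_sets.subset0 => x [M FM Mx].
    by case: (FP _ FM) => [M0|Mav]; [rewrite M0 in Mx | case: no; exists M].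
  right; pose F' M := F M /\ avoids M.
  have -> : (\bigcup_(M in F) M)%classic = (fun b => exists2 M, F' M & M b).
    apply/seteqP; split=> b [M FM Mb]; last by exists M => //; case: FM.
    by exists M => //; split=> //; case: (FP _ FM) => // M0'; rewrite M0' in Mb.
  split.
  - apply: rwm_chain_union; first by exists M0.
      by move=> M [_ []].
    by move=> M N [FM _] [FN _]; apply: Ftot.
  - by move=> b Jb; exists M0; [split | case: av0 => _ JM0 _; exact: JM0].
  - by move=> [M [_ [_ _]]].
have {Mav} [MR JM nMa] : avoids M.
  case: Mav => // M0; exfalso; apply: (Mmax J); last by right; split.
  by rewrite M0; split=> [|J0] //; have [[[J00 _ _] _] _ _] := JR; exact: (J0 0).
have max_colon b : ~ M b -> forall c, M (c * b) -> M c \/ M (a * b).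
  move=> nMb c Mcb; apply: contrapT => /not_orP[nMc nMab].
  have [[MI _] _ _] := MR.
  case: (Mmax (fun r => M (r * b))); first split.
  - by move=> r Mr; exact: idealMr.
  - by move=> /(_ c Mcb).
  right; split=> //; first exact: rwm_colon.
  by move=> r /JM Mr; exact: idealMr.
have [[MI Ms] _ Mr] := MR.
exists M; split=> //; split=> // [M1|b c Mbc].
  by apply: nMa; rewrite -[a]mulr1; exact: idealMl.
apply: contrapT => /not_orP[nMb nMc].
have [//|Mac] := max_colon c nMc b Mbc.
rewrite mulrC in Mac; have [//|Maa] := max_colon a nMa c Mac.
by apply: nMa; apply: (Mr a 2).
Qed.

End PrimeSigmaIdeals.

(* The ring is kept abstract because convertibility checks between elements of
   {malg K[_]} blow up. *)
Section Monomials.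
Variables (R : comPzRingType) (sigma : {rmorphism R -> R}) (n : nat).
Variable var : 'I_n -> nat -> R.
Hypothesis sigma_varE : forall i j, sigma (var i j) = var i j.+1.
Local Notation V := {ffun 'I_n -> {poly int}}.
Implicit Types (f g h : 'I_n -> {poly nat}) (i : 'I_n) (j : nat) (u v : V).

Definition monomial f : R := \prod_(i < n) sigma_pow sigma (var i 0) (f i).
Local Notation mon := monomial.

Lemma iter_sigma_var i j k : iter k (sigma) (var i j) = var i (j + k).
Proof.
elim: k => [|k IH]; first by rewrite addn0.
by rewrite iterS IH addnS sigma_varE.
Qed.

Lemma monomialE m f : (forall i, (size (f i) <= m)%N) ->
  mon f = \prod_i \prod_(j < m) var i j ^+ ((f i)`_j)%R.
Proof.
move=> fm; apply: eq_bigr => i _; rewrite /sigma_pow.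
rewrite (big_ord_widen m (fun j => iter j (sigma) (var i 0) ^+ ((f i)`_j)%R)) //.
rewrite big_mkcond; apply: eq_bigr => j _; rewrite iter_sigma_var add0n.
by case: ltnP => // fj; rewrite nth_default.
Qed.

Lemma common_size f g : exists m, forall i, (size (f i) <= m)%N /\ (size (g i) <= m)%N.
Proof.
exists (\max_i (size (f i) + size (g i)))%N => i.
by have := leq_bigmax (F := fun i => size (f i) + size (g i))%N i; lia.
Qed.

Lemma eq_monomial f g : (forall i j, (f i)`_j = (g i)`_j) -> mon f = mon g.
Proof. by move=> fg; apply: eq_bigr => i _; congr sigma_pow; apply/polyP. Qed.

Lemma monomial0 : mon (fun=> 0) = 1.
Proof. by apply: big1 => i _; rewrite /sigma_pow size_poly0 big_ord0. Qed.

Lemma monomialD f g : mon (fun i => f i + g i) = mon f * mon g.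
Proof.
have [m fgm] := common_size f g.
rewrite (@monomialE m f) => [|i]; last by case: (fgm i).
rewrite (@monomialE m g) => [|i]; last by case: (fgm i).
rewrite (@monomialE m) => [|i]; last first.
  by apply: leq_trans (size_polyD _ _) _; rewrite geq_max; apply/andP.
rewrite -big_split; apply: eq_bigr => i _.
by rewrite -big_split; apply: eq_bigr => j _; rewrite coefD exprD.
Qed.

Lemma sigma_monomial f : sigma (mon f) = mon (fun i => f i * 'X).
Proof.
have [m fm] := common_size f f.
rewrite (@monomialE m) => [|i]; last by case: (fm i).
rewrite (@monomialE m.+1) => [|i]; last first.
  by apply: leq_trans (size_polyMleq _ _) _; rewrite size_polyX addn2; case: (fm i).
rewrite rmorph_prod; apply: eq_bigr => i _.
rewrite rmorph_prod big_ord_recl coefMX expr0 mul1r; apply: eq_bigr => j _.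
by rewrite rmorphXn sigma_varE coefMX.
Qed.

(** * The relation lattice of one prime sigma-ideal *)

Section AtPrime.
Variables (P : R -> Prop) (PP : prime_sigma_ideal sigma P).

Let PI : is_ideal P. Proof. by case: (prime_sigma PP). Qed.

Definition outside i j : Prop := ~ P (var i j).

Lemma outsideS i j : outside i j.+1 -> outside i j.
Proof.
apply: contra_not => Pij; rewrite -sigma_varE.
by case: (prime_sigma PP) => _; apply.
Qed.

Lemma prime_monomial f : P (mon f) <-> exists i j, (f i)`_j <> 0%N /\ P (var i j).
Proof.
have [m fm] := common_size f f.
have {}fm i : (size (f i) <= m)%N by case: (fm i).
have prime_prod (I : finType) (F : I -> R) : P (\prod_x F x) -> exists x, P (F x).
  elim/big_ind: _ => [/(prime_proper PP)|x y IHx IHy /(primeM PP)[]|x _ Px] //.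
  by exists x.
split=> [|[i [j [fij Pij]]]].
  rewrite (monomialE fm) => /prime_prod[i /prime_prod[j Pij]].
  exists i, j; split; last exact: primeX PP Pij.
  by move=> f0; rewrite f0 in Pij; case: (prime_proper PP).
have jm : (j < m)%N.
  by rewrite ltnNge; apply/negP => mj; apply: fij; rewrite nth_default // (leq_trans (fm i)).
rewrite (monomialE fm) (bigD1 i) //= (bigD1 (Ordinal jm)) //=.
do 2!apply: idealMr => //.
by case: ((f i)`_j) fij => // k _; rewrite exprS; apply: idealMr.
Qed.

Lemma monomial_notin f : ~ P (mon f) <-> forall i j, (f i)`_j <> 0%N -> outside i j.
Proof.
split=> [nf i j fij Pij|fin /prime_monomial[i [j [fij]]]]; last exact: fin.
by apply: nf; apply/prime_monomial; exists i, j.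
Qed.

Lemma congruent_monomials f g : P (mon f - mon g) -> P (mon f) <-> P (mon g).
Proof.
move=> fg; split=> [Pf|Pg].
  by rewrite -[mon g](subKr (mon f)); apply: idealB.
by rewrite -[mon f](subrK (mon g)); apply: idealD.
Qed.

Definition pos_part u i : {poly nat} :=
  \poly_(j < size (u i)) (if 0 < expo (i, j) u then `|expo (i, j) u|%N else 0%N).

Lemma coef_pos_part u i j :
  (pos_part u i)`_j = if 0 < expo (i, j) u then `|expo (i, j) u|%N else 0%N.
Proof. by rewrite coef_poly; case: ltnP => // uj; rewrite /expo nth_default. Qed.

Definition neg_part u := pos_part (- u).

Lemma coef_neg_part u i j :
  (neg_part u i)`_j = if expo (i, j) u < 0 then `|expo (i, j) u|%N else 0%N.
Proof.
by rewrite coef_pos_part /expo ffunE coefN oppr_gt0 abszN.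
Qed.

(** The first condition keeps both monomials outside [P], so that they can be cancelled modulo
    [P]. *)
Definition relation_lattice u : Prop :=
  in_bounds outside u /\ P (mon (pos_part u) - mon (neg_part u)).

Definition expo_diff u f g : Prop :=
  forall i j, expo (i, j) u = ((f i)`_j)%R%:Z - ((g i)`_j)%R%:Z.

Lemma expo_diff_parts u : expo_diff u (pos_part u) (neg_part u).
Proof.
by move=> i j; rewrite coef_pos_part coef_neg_part; case: ltgtP; lia.
Qed.

(** The pair [f], [g] differs from the reduced pair by the common factor [mon h], with [h] the
    coefficientwise minimum. It divides [mon f], so it lies outside [P] and cancels. *)
Lemma relation_latticeE u f g : expo_diff u f g -> ~ P (mon f) -> ~ P (mon g) ->
  relation_lattice u <-> P (mon f - mon g).
Proof.
move=> ufg nf ng.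
have ub : in_bounds outside u.
  move=> i j; rewrite ufg => fg.
  have [fij|fij] := pselect ((f i)`_j = 0%N); last exact: (monomial_notin f).1 nf _ _ fij.
  by apply: (monomial_notin g).1 ng _ _ _ => gij; apply: fg; rewrite fij gij.
pose h i : {poly nat} := \poly_(j < size (f i)) minn ((f i)`_j)%R ((g i)`_j)%R.
have hE i j : (h i)`_j = minn ((f i)`_j)%R ((g i)`_j)%R.
  by rewrite coef_poly; case: ltnP => // fj; rewrite (nth_default _ fj) min0n.
have fE : mon f = mon h * mon (pos_part u).
  rewrite -monomialD; apply: eq_monomial => i j.
  rewrite coefD hE coef_pos_part ufg; move: (f i)`_j (g i)`_j => x y.
  by rewrite natrDE; case: ifP; lia.
have gE : mon g = mon h * mon (neg_part u).
  rewrite -monomialD; apply: eq_monomial => i j.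
  rewrite coefD hE coef_neg_part ufg; move: (f i)`_j (g i)`_j => x y.
  by rewrite natrDE; case: ifP; lia.
rewrite fE gE -mulrBr; split=> [[_ Pu]|/(primeM PP)[Ph|//]]; first exact: idealMl.
by case: nf; rewrite fE; apply: idealMr.
Qed.

Lemma pos_part_notin u : in_bounds outside u -> ~ P (mon (pos_part u)).
Proof.
move=> uin; apply/monomial_notin => i j; rewrite coef_pos_part => uij.
by apply: uin; move: uij; case: ifP; lia.
Qed.

Lemma neg_part_notin u : neg_in_bounds outside u -> ~ P (mon (neg_part u)).
Proof.
move=> uin; apply/monomial_notin => i j; rewrite coef_neg_part => uij.
by apply: uin; move: uij; case: ifP; lia.
Qed.

Lemma relation_lattice_subgroup : subgroup relation_lattice.
Proof.
split=> [|u v [uin Pu] [vin Pv]].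
  apply/(@relation_latticeE _ (fun=> 0) (fun=> 0)); rewrite ?monomial0 ?subrr.
  - by move=> i j; rewrite /expo ffunE !coef0.
  - exact: prime_proper PP.
  - exact: prime_proper PP.
  - exact: ideal0.
have uneg := neg_part_notin (in_bounds_neg uin).
have vneg := neg_part_notin (in_bounds_neg vin).
have upos := pos_part_notin uin.
have vpos := pos_part_notin vin.
(* This pair represents [u - v] without having to be reduced. *)
apply/(@relation_latticeE _ (fun i => pos_part u i + neg_part v i)
                            (fun i => neg_part u i + pos_part v i)).
- move=> i j; rewrite expoB !expo_diff_parts !coefD.
  by rewrite !natrDE !PoszD; lia.
- by rewrite monomialD => /(primeM PP)[].
- by rewrite monomialD => /(primeM PP)[].
rewrite !monomialD.
set a := mon _ in Pu *; set b := mon (neg_part v) in Pv *.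
set c := mon _ in Pu *; set d := mon _ in Pv *.
have -> : a * b - c * d = b * (a - c) - c * (d - b) by ring.
by apply: idealB => //; apply: idealMl.
Qed.

(** Applying [sigma] preserves the congruence. The hypothesis keeps the negative monomial out of
    [P], and the congruence then keeps the positive one out too. *)
Lemma relation_lattice_shift u : relation_lattice u ->
  neg_in_bounds outside (shift u) -> relation_lattice (shift u).
Proof.
move=> [uin Pu] xneg.
have Px : P (mon (fun i => pos_part u i * 'X) - mon (fun i => neg_part u i * 'X)).
  rewrite -!sigma_monomial -rmorphB.
  by case: (prime_sigma PP) => _; apply.
have nneg : ~ P (mon (fun i => neg_part u i * 'X)).
  apply/monomial_notin => i [|j]; rewrite coefMX //= coef_neg_part => uij.
  by apply: xneg; rewrite expo_shift; move: uij; case: ifP.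
apply/relation_latticeE; last exact: Px.
- move=> i [|j]; rewrite !coefMX /=; first by rewrite expo_shift0.
  by rewrite expo_shift expo_diff_parts.
- by move/(congruent_monomials Px).
- exact: nneg.
Qed.

End AtPrime.

(** * Ultrafilters on the set of prime sigma-ideals *)

Section Ultraproduct.
Local Notation prime_ideals := {P : R -> Prop | prime_sigma_ideal sigma P}.
Variables (U : set_system prime_ideals) (UU : UltraFilter U).
Implicit Types P : prime_ideals.

Let UF : Filter U.
Proof. exact: filter_filter. Qed.

Let UN0 : ~ U (fun=> False).
Proof. exact: filter_not_empty. Qed.

(** For each [i], take the least [m] with [var i m] almost surely in the prime: membership of that
    variable passes to all larger [j], so one member of [U] serves all [j]. *)
Lemma eventually_vars :
  U (fun P => forall i j, U (fun Q => sval Q (var i j)) -> sval P (var i j)).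
Proof.
suff : U (fun P => forall i, i \in enum 'I_n ->
    forall j, U (fun Q => sval Q (var i j)) -> sval P (var i j)).
  by apply: filterS => P Pin i; apply: Pin; rewrite mem_enum.
apply: filter_all_seq => i _.
have [ex|no] := pselect (exists j, `[< U (fun Q => sval Q (var i j)) >]); last first.
  by apply: filterS filterT => P _ j Uj; case: no; exists j; apply/asboolP.
case: (ex_minnP ex) => m /asboolP Um mmin; apply: filterS Um => P Pm j Uj.
have mj : (m <= j)%N by apply: mmin; apply/asboolP.
apply: contrapT => nPj.
exact: (inb_le (fun P => @outsideS _ (svalP P)) mj (P := P) nPj).
Qed.

Lemma eventually_monomial f : U (fun P => sval P (mon f)) ->
  exists i j, (f i)`_j <> 0%N /\ U (fun P => sval P (var i j)).
Proof.
move=> Uf; apply: contrapT => no; apply: UN0.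
have [m fm] := common_size f f.
pose s := [seq (i, j) | i <- enum 'I_n, j <- iota 0 m].
have : U (fun P => forall p, p \in s -> (f p.1)`_p.2 <> 0%N -> ~ sval P (var p.1 p.2)).
  apply: filter_all_seq => -[i j] _ /=.
  have [f0|fij] := pselect ((f i)`_j = 0%N); first by apply: filterS filterT.
  have nU : ~ U (fun P => sval P (var i j)) by move=> Uij; apply: no; exists i, j.
  by apply: filterS (ultra_not UU nU).
move=> Us; apply: filterS (filterI Uf Us) => P [/(prime_monomial (svalP P))].
move=> [i [j [fij Pij]]] /(_ (i, j)) /=; apply=> //.
apply/allpairsP; exists (i, j); rewrite mem_enum mem_iota; split=> //=.
rewrite add0n ltnNge; apply/negP => mj; apply: fij.
by rewrite nth_default // (leq_trans (fm i).1).
Qed.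

Let expo_of f g : V := [ffun i => map_poly Posz (f i) - map_poly Posz (g i)].

Let expo_ofE f g : expo_diff (expo_of f g) f g.
Proof. by move=> i j; rewrite /expo ffunE coefB !coef_map_id0. Qed.

(** If both monomials lie in [P], so does their difference; otherwise [eventually_full_LamU]
    applies, with the monomial outside [P] on the negative side. *)
Lemma eventually_binomials : U (fun P => forall f g,
  U (fun Q => sval Q (mon f - mon g)) -> sval P (mon f - mon g)).
Proof.
have full := eventually_full_LamU UU (fun P => outsideS (svalP P))
  (fun P => relation_lattice_subgroup (svalP P)) (fun P u uL => uL.1)
  (fun P => @relation_lattice_shift _ (svalP P)).
apply: filterS (filterI (full : U _) eventually_vars) => P [Pfull Pvars] f g Ufg.
have PP := svalP P; have [PI _] := prime_sigma PP.
have one_side f' g' : U (fun Q => sval Q (mon f' - mon g')) ->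
    ~ sval P (mon g') -> sval P (mon f' - mon g').
  move=> Ufg' ng.
  (* A monomial almost surely in [Q] has a variable almost surely in [Q], which by [Pvars] lies in
     [P]. *)
  have Ung : ~ U (fun Q => sval Q (mon g')).
    move=> /eventually_monomial[i [j [gij /Pvars Pij]]].
    by apply: ng; apply/(prime_monomial PP); exists i, j.
  have Lu : LamU U (fun Q => relation_lattice (sval Q)) (expo_of f' g').
    rewrite /LamU; apply: filterS (filterI Ufg' (ultra_not UU Ung)) => Q [Qfg nQg].
    apply/(relation_latticeE (svalP Q) (expo_ofE f' g')) => //.
    by move/(congruent_monomials (svalP Q) Qfg).
  have gout := (monomial_notin PP g').1 ng.
  have Pu : relation_lattice (sval P) (expo_of f' g').
    apply: Pfull => // i j; rewrite expo_ofE => neg; apply: gout => g0.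
    by rewrite g0 in neg; lia.
  (* A variable of [mon f'] either survives in the difference and is outside [P] by [Pu], or cancels
     against one of [mon g']. *)
  apply/(relation_latticeE PP (expo_ofE f' g')) => //.
  apply/(monomial_notin PP) => i j fij.
  have [u0|] := pselect (expo (i, j) (expo_of f' g') = 0); last exact: Pu.1.
  by apply: gout => g0; apply: fij; move: u0; rewrite expo_ofE g0; lia.
have [Pg|ng] := pselect (sval P (mon g)); last exact: one_side.
have [Pf|nf] := pselect (sval P (mon f)); first exact: idealB.
rewrite -opprB; apply: idealN => //; apply: one_side => //.
apply: filterS Ufg => Q Qfg; have [QI _] := prime_sigma (svalP Q).
by rewrite -opprB; apply: idealN.
Qed.

End Ultraproduct.

(** If no [s] works, the sets [bad s] are nonempty and generate a proper filter. In an ultrafilter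
    above it each element of [B] is almost surely in the prime, so some prime contains all of [B],
    against [bad [::]]. *)
Lemma binomial_prime_basis (B : R -> Prop) :
  (forall b, B b -> exists f g, b = mon f - mon g) ->
  exists2 s : seq R, (forall b, b \in s -> B b) &
    forall P, prime_sigma_ideal sigma P -> (forall b, b \in s -> P b) ->
      forall b, B b -> P b.
Proof.
move=> Bbin; apply: contrapT => no_basis.
pose T := {P : R -> Prop | prime_sigma_ideal sigma P}.
pose bad (s : seq R) (P : T) :=
  (forall b, b \in s -> sval P b) /\ ~ (forall b, B b -> sval P b).
pose F : set_system T := fun Q =>
  exists2 s : seq R, (forall b, b \in s -> B b) & forall P, bad s P -> Q P.
have FF : ProperFilter F.
  split=> [[s sB sF]|].
    apply: no_basis; exists s => // P PP Ps b Bb; apply: contrapT => nPb.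
    by apply: (sF (exist _ P PP)); split=> //= PB; apply: nPb; apply: PB.
  split=> [|Q Q' [s sB sQ] [s' s'B s'Q]|Q Q' QQ' [s sB sQ]].
  - by exists [::].
  - exists (s ++ s') => [b|P [Ps nPB]]; first by rewrite mem_cat => /orP[/sB|/s'B].
    split; [apply: sQ|apply: s'Q]; split=> // b bs; apply: Ps; rewrite mem_cat bs ?orbT //.
  - by exists s => // P /sQ/QQ'.
have [U [UU FU]] := ultraFilterLemma FF.
have UF : Filter U := filter_filter.
have UB b : B b -> U (fun P => sval P b).
  move=> Bb; apply: FU; exists [:: b] => [b'|P [Pb _]]; first by rewrite inE => /eqP->.
  by apply: Pb; rewrite mem_head.
have Ubad : U (bad [::]) by apply: FU; exists [::].
apply: (@filter_not_empty _ U); apply: filterS (filterI Ubad (eventually_binomials UU)).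
move=> P [[_ nPB] Pbin]; apply: nPB => b Bb.
by have [f [g bE]] := Bbin b Bb; rewrite bE; apply: Pbin; rewrite -bE; apply: UB.
Qed.

End Monomials.

(** An element outside a radical well-mixed ideal containing [F] is missed by a prime above that
    ideal; this prime contains [B], hence [I]. *)
Lemma rwm_span_prime_basis (R : comPzRingType) (sigma : {rmorphism R -> R})
    (I B F : R -> Prop) :
  (forall a, I a <-> sigma_span sigma B a) -> (forall b, F b -> B b) ->
  (forall P, prime_sigma_ideal sigma P -> (forall b, F b -> P b) ->
     forall b, B b -> P b) ->
  forall a, rwm_span sigma I a <-> rwm_span sigma F a.
Proof.
move=> IB FB basis a; split=> [Ia J JR FJ|Fa J JR IJ]; last first.
  apply: Fa => // b /FB Bb; apply: IJ; apply/IB => M _; exact.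
apply: contrapT => nJa; have [P [PP JP nPa]] := prime_avoiding JR nJa.
apply: nPa; apply: Ia; first exact: prime_radical_well_mixed.
move=> b /IB; apply; first exact: prime_sigma.
by apply: basis => // c /FJ/JP.
Qed.

Theorem theorem3p15 (K : fieldType) (sigma : {rmorphism K -> K})
    (charK : [pchar K]%R =i pred0) (n : nat) (n_gt0 : (0 < n)%N)
    (I : sigma_polynomial K n -> Prop)
    (hI : pure_binomial_sigma_ideal sigma I) :
  exists F : seq (sigma_polynomial K n),
    forall a : sigma_polynomial K n,
      rwm_span (sigma_ext sigma n) I a <->
      rwm_span (sigma_ext sigma n) (fun b => b \in F) a.
Proof.
have [B Bbin IB] := hI.
(* Pure binomials unfold to differences of [monomial] for the variables [sigma_var], so [Bbin] fits
   by conversion. *)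
have [s sB basis] := binomial_prime_basis (@sigma_ext_var K sigma n) Bbin.
by exists s; exact: (rwm_span_prime_basis IB sB basis).
Qed.
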